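(* Consider the system $x_{t+1}=\bar Ax_t+\bar Bu_t+w_t$, $t\in\{0,1,2,\dots\}$, with $x_t\in\mathbb R^n$, $u_t\in\mathbb R^m$, where $(w_t)_{t\ge0}$ is an i.i.d. sequence of $\mathbb R^n$-valued random vectors with finite second moment matrix $\Sigma=\mathbb E[w_tw_t^{\mathsf T}]$, and where $\bar A$ is Schur stable (all eigenvalues of $\bar A$ have absolute value strictly less than $1$). Let $1\le N_c\le N$ be any control horizon, and let $\pi^*$ be the receding horizon policy with optimization horizon $N$, control horizon $N_c$ and input bound $\|u_t\|_\infty\le U_{\max}$ described in the context. Then the closed-loop system under $\pi^*$ is mean-square bounded: for every initial condition $x_0\in\mathbb R^n$, $$\sup_{t\ge 0}\ \mathbb E_{x_0}\big[\|x_t\|^2\big]<\infty .$$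
   Context: $\mathbb E_{x_0}$ denotes expectation given the initial state $x_0$, and $\|\cdot\|$ is the Euclidean norm. Finite-horizon problem. Fix $N\in\{1,2,\dots\}$, $U_{\max}>0$, and symmetric positive definite weights $Q_0,\dots,Q_N\in\mathbb R^{n\times n}$ and $R_0,\dots,R_{N-1}\in\mathbb R^{m\times m}$. Let $\tilde\varphi:\mathbb R\to\mathbb R$ be a measurable function with $\sup_{s\in\mathbb R}|\tilde\varphi(s)|=\phi_{\max}<\infty$, and for $v\in\mathbb R^n$ put $\mathfrak e(v)=(\tilde\varphi(v_1),\dots,\tilde\varphi(v_n))^{\mathsf T}$. Assume $\mathbb E[\mathfrak e(w_t)]=0$. Given a state $\bar x\in\mathbb R^n$ at the start of the horizon, consider policies $$u_t=\eta_t+\sum_{i=0}^{t-1}\theta_{t,i}\,\mathfrak e(w_i),\quad t=0,\dots,N-1,\qquad \eta_t\in\mathbb R^m,\ \theta_{t,i}\in\mathbb R^{m\times n}.$$ Write $\Theta_t=[\theta_{t,0}\ \cdots\ \theta_{t,t-1}\ 0\ \cdots\ 0]$, and let $\eta_{t,j}$, $\Theta_{t,j}$ denote the $j$-th rows of $\eta_t$, $\Theta_t$. Let $(\eta^*(\bar x),\Theta^*(\bar x))$ be a minimizer of $$\mathbb E\Big[\sum_{k=0}^{N-1}\big(x_k^{\mathsf T}Q_kx_k+u_k^{\mathsf T}R_ku_k\big)+x_N^{\mathsf T}Q_Nx_N\ \Big|\ x_0=\bar x\Big]$$ (under the system dynamics) subject to $$\max_{j=1,\dots,m}\big(|\eta_{t,j}|+\|\Theta_{t,j}\|_1\,\phi_{\max}\big)\le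 U_{\max},\qquad t=0,\dots,N-1 .$$ The minimizer is chosen as a Borel measurable function of $\bar x$. These constraints guarantee $\|u_t\|_\infty\le U_{\max}$ for every noise realization. Receding horizon policy $\pi^*$. At each time $kN_c$, $k=0,1,2,\dots$, the state $x_{kN_c}$ is measured and the finite-horizon problem is solved with $\bar x=x_{kN_c}$. The first $N_c$ elements of the resulting policy are applied, driven by the noise occurring after time $kN_c$: for $\ell=0,\dots,N_c-1$, $$u_{kN_c+\ell}=\eta^*_\ell(x_{kN_c})+\sum_{i=0}^{\ell-1}\theta^*_{\ell,i}(x_{kN_c})\,\mathfrak e(w_{kN_c+i}).$$ (The noise values are recovered from the perfectly observed states.) Then $k$ is increased by one and the procedure repeats. *)

(* Defs.v *)
From HB Require Import structures.
From mathcomp Require Import all_boot all_order all_algebra.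
From mathcomp Require Import finmap complex.
From mathcomp Require Import all_classical all_reals all_analysis.

Set Implicit Arguments.
Unset Strict Implicit.
Unset Printing Implicit Defensive.

Import Order.TTheory GRing.Theory Num.Theory.
Import numFieldNormedType.Exports.

Local Open Scope classical_set_scope.
Local Open Scope ring_scope.

Definition borel_mx (R : realType) (p q : nat) :=
  g_sigma_algebraType (@open 'M[R]_(p, q)).

(* The Euclidean norm; [`|v|] on matrices is the max norm. *)
Definition enorm (R : realType) (p : nat) (v : 'cV[R]_p) : R :=
  Num.sqrt (\sum_(i < p) v i ord0 ^+ 2).

Definition qform (R : realType) (p : nat) (Q : 'M[R]_p) (v : 'cV[R]_p) : R :=
  (v^T *m Q *m v) ord0 ord0.

Definition sym_posdef (R : realType) (p : nat) (Q : 'M[R]_p) : Prop :=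
  Q^T = Q /\ forall v : 'cV[R]_p, v != 0 -> 0 < qform Q v.

(* The eigenvalues are the complex ones: A is viewed as a matrix over R[i]. *)
Definition schur_stable (R : realType) (p : nat) (A : 'M[R]_p) : Prop :=
  forall z : R[i], eigenvalue (map_mx (real_complex R) A) z -> `|z| < 1.

Section iid.
Context d (T : measurableType d) (R : realType) (P : probability T R) (p : nat).
Implicit Type w : nat -> T -> 'cV[R]_p.

Definition mutually_independent w : Prop :=
  forall (J : {fset nat}) (B : nat -> set (borel_mx R p 1)),
    (forall t, measurable (B t)) ->
    P (\bigcap_(t in [set` J]) (w t @^-1` B t)) =
    (\prod_(t <- J) P (w t @^-1` B t))%E.

Definition identically_distributed w : Prop :=
  forall (t : nat) (B : set (borel_mx R p 1)),
    measurable B -> P (w t @^-1` B) = P (w 0%N @^-1` B).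

Definition iid w : Prop :=
  [/\ forall t, measurable_fun setT (w t : T -> borel_mx R p 1),
      mutually_independent w & identically_distributed w].

Definition second_moment w (Sigma : 'M[R]_p) : Prop :=
  forall t i j,
    P.-integrable setT (fun o => ((w t o *m (w t o)^T) i j)%:E) /\
    ('E_P[fun o => (w t o *m (w t o)^T) i j] = (Sigma i j)%:E)%E.

End iid.

(* In a policy of horizon N only the entries [eta t] and [theta t i] with
   i < t < N are ever used. *)
Record policy (R : realType) (n m : nat) := Policy {
  eta : nat -> 'cV[R]_m ;
  theta : nat -> nat -> 'M[R]_(m, n) }.

Section finite_horizon.
Context (R : realType) (n m : nat).
Variables (A : 'M[R]_n) (B : 'M[R]_(n, m)) (N : nat).
Variables (Q : nat -> 'M[R]_n) (W : nat -> 'M[R]_m).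
Variables (phi : R -> R) (phi_max Umax : R).

Definition noise_fun (v : 'cV[R]_n) : 'cV[R]_n := \col_i phi (v i ord0).

Definition policy_input (p : policy R n m) (w : nat -> 'cV[R]_n) (t : nat) :
    'cV[R]_m :=
  eta p t + \sum_(i < t) theta p t i *m noise_fun (w i).

Fixpoint policy_state (p : policy R n m) (xbar : 'cV[R]_n)
    (w : nat -> 'cV[R]_n) (t : nat) : 'cV[R]_n :=
  if t is t'.+1 then
    A *m policy_state p xbar w t' + B *m policy_input p w t' + w t'
  else xbar.

Definition pathwise_cost (p : policy R n m) (xbar : 'cV[R]_n)
    (w : nat -> 'cV[R]_n) : R :=
  \sum_(k < N) (qform (Q k) (policy_state p xbar w k)
                + qform (W k) (policy_input p w k))
  + qform (Q N) (policy_state p xbar w N).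

Definition Theta (p : policy R n m) (t : nat) : 'M[R]_(m, \sum_(i < N) n) :=
  \mxrow_(i < N) (if (i < t)%N then theta p t i else 0).

Definition norm1 (q : nat) (v : 'rV[R]_q) : R := \sum_(k < q) `|v ord0 k|.

Definition feasible (p : policy R n m) : Prop :=
  forall t, (t < N)%N ->
    \big[Num.max/0]_(j < m)
      (`|eta p t j ord0| + norm1 (row j (Theta p t)) * phi_max) <= Umax.

Context d (T : measurableType d) (P : probability T R).
Variable w : nat -> T -> 'cV[R]_n.

Definition expected_cost (p : policy R n m) (xbar : 'cV[R]_n) : \bar R :=
  ('E_P[fun o => pathwise_cost p xbar (fun t => w t o)])%E.

Definition is_minimizer (xbar : 'cV[R]_n) (p : policy R n m) : Prop :=
  feasible p /\
  forall p', feasible p' -> (expected_cost p xbar <= expected_cost p' xbar)%E.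

Definition borel_selection (pstar : 'cV[R]_n -> policy R n m) : Prop :=
  forall t, (t < N)%N ->
    measurable_fun setT
      ((fun xbar => eta (pstar xbar) t) : borel_mx R n 1 -> borel_mx R m 1) /\
    forall i, (i < t)%N ->
      measurable_fun setT
        ((fun xbar => theta (pstar xbar) t i)
           : borel_mx R n 1 -> borel_mx R m n).

(* The state and input processes of the closed loop started at x0: in block k
   the policy computed from x_(k Nc) is driven by the noise from time k Nc on. *)
Definition receding_horizon_loop (Nc : nat) (pstar : 'cV[R]_n -> policy R n m)
    (x0 : 'cV[R]_n) (x : nat -> T -> 'cV[R]_n) (u : nat -> T -> 'cV[R]_m) :
    Prop :=
  [/\ forall o, x 0%N o = x0,
      forall t o, x t.+1 o = A *m x t o + B *m u t o + w t o
    & forall k l o, (l < Nc)%N ->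
        u (k * Nc + l)%N o =
        policy_input (pstar (x (k * Nc)%N o)) (fun i => w (k * Nc + i)%N o) l].

End finite_horizon.

(* Main.v *)
(* The constraints bound the input uniformly, so the state is the response of a
   stable linear system to forcing terms z_s with bounded second moment:
   x_t = sum_(s <= t) A^s z_(t - s), where z_0 = x_0 and z_(s+1) = B u_s + w_s.
   Since sum_s |A^s| <= C, Cauchy-Schwarz with weights |A^s| gives the pathwise
   bound |x_t|^2 <= C sum_s |A^s| |z_(t - s)|^2, and taking expectations bounds
   E |x_t|^2 by C^2 sup_s E |z_s|^2.
   The summability of |A^s| is proved without the Jordan form: by
   Cayley-Hamilton the product of the A - z over the eigenvalues z is 0, and
   the factors are peeled off one at a time. *)
Require Import Defs.
From mathcomp Require Import all_boot all_order all_algebra.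
From mathcomp Require Import complex.
From mathcomp Require Import all_classical all_reals all_analysis.
From mathcomp Require Import ring lra.

Set Implicit Arguments.
Unset Strict Implicit.

Import Order.TTheory GRing.Theory Num.Theory.
Import numFieldNormedType.Exports.
Local Open Scope classical_set_scope.
Local Open Scope ring_scope.

(** * The entrywise norm of a matrix *)

(** Unlike the max norm, it is submultiplicative, and it makes sense over [R] and [R[i]] alike. *)
Definition l1norm (K : numDomainType) p q (M : 'M[K]_(p, q)) : K :=
  \sum_i \sum_j `|M i j|.

Section l1norm.
Context (K : numDomainType).

Lemma l1norm_ge0 p q (M : 'M[K]_(p, q)) : 0 <= l1norm M.
Proof. by apply: sumr_ge0 => i _; apply: sumr_ge0 => j _. Qed.

Lemma ler_l1normD p q (M M' : 'M[K]_(p, q)) :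
  l1norm (M + M') <= l1norm M + l1norm M'.
Proof.
rewrite /l1norm -big_split ler_sum// => i _.
by rewrite -big_split ler_sum// => j _; rewrite mxE ler_normD.
Qed.

Lemma l1normZ p q a (M : 'M[K]_(p, q)) : l1norm (a *: M) = `|a| * l1norm M.
Proof.
rewrite /l1norm mulr_sumr; apply: eq_bigr => i _.
by rewrite mulr_sumr; apply: eq_bigr => j _; rewrite mxE normrM.
Qed.

Lemma l1norm0 p q : l1norm (0 : 'M[K]_(p, q)) = 0.
Proof. by apply: big1 => i _; apply: big1 => j _; rewrite mxE normr0. Qed.

Lemma ler_l1norm_sum p q (I : Type) (r : seq I) (F : I -> 'M[K]_(p, q)) :
  l1norm (\sum_(i <- r) F i) <= \sum_(i <- r) l1norm (F i).
Proof.
elim/big_rec2: _ => [|i y M _ le]; first by rewrite l1norm0.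
by rewrite (le_trans (ler_l1normD _ _))// lerD2l.
Qed.

Lemma ler_l1normM p q r (M : 'M[K]_(p, q)) (M' : 'M[K]_(q, r)) :
  l1norm (M *m M') <= l1norm M * l1norm M'.
Proof.
rewrite /l1norm mulr_suml ler_sum// => i _; rewrite mulr_suml.
under eq_bigr do rewrite mxE.
apply: (@le_trans _ _ (\sum_k \sum_j `|M i j| * `|M' j k|)).
  apply: ler_sum => k _; apply: le_trans (ler_norm_sum _ _ _) _.
  by apply: ler_sum => j _; rewrite normrM.
rewrite exchange_big ler_sum// => j _; rewrite -mulr_sumr ler_wpM2l//.
by rewrite [leRHS](bigD1 j)//= lerDl sumr_ge0// => ? _; rewrite sumr_ge0.
Qed.

End l1norm.

(** * Summability of the powers of a Schur stable matrix *)

(* Y_k = A^k X satisfies Y_(k+1) = z Y_k + A^k (A - z) X, where |z| < 1 and the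
   last term is summable by induction. *)
Lemma sum_l1norm_pow_bounded (K : numFieldType) n (A : 'M[K]_n.+1)
    (s : seq K) (X : 'M[K]_n.+1) :
  (forall z, z \in s -> `|z| < 1) ->
  (\prod_(z <- s) (A - z%:M)) * X = 0 ->
  exists C, forall t, \sum_(k < t) l1norm (A ^+ k * X) <= C.
Proof.
elim/last_ind: s X => [|s z IHs] X s1.
  rewrite big_nil mul1r => ->; exists 0 => t.
  by rewrite big1// => k _; rewrite mulr0 l1norm0.
rewrite -cats1 big_cat big_seq1 /= -mulrA => /IHs[y ys|C hC].
  by apply: s1; rewrite mem_rcons inE ys orbT.
have z1 : 0 < 1 - `|z| by rewrite subr_gt0 s1// mem_rcons inE eqxx.
(* With S_t the sum of the first t norms, S_t <= S_(t+1) <= |X| + C + |z| S_t, which is solved for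
   S_t since |z| < 1. *)
exists ((l1norm X + C) / (1 - `|z|)) => t.
rewrite ler_pdivlMr// mulrBr mulr1 lerBlDr.
have step k : l1norm (A ^+ k.+1 * X)
    <= l1norm (A ^+ k * ((A - z%:M) * X)) + `|z| * l1norm (A ^+ k * X).
  rewrite -l1normZ; apply: le_trans _ (ler_l1normD _ _).
  rewrite exprSr mulrBl mulrBr -mulrA.
  by rewrite -[in z%:M * X]mulmxE mul_scalar_mx -scalerAr subrK.
apply: (@le_trans _ _ (\sum_(k < t.+1) l1norm (A ^+ k * X))).
  by rewrite big_ord_recr lerDl l1norm_ge0.
rewrite big_ord_recl expr0 mul1r -addrA lerD2l.
apply: le_trans (ler_sum _ (fun (k : 'I_t) _ => step k)) _.
by rewrite big_split /= -mulr_sumr [X in _ <= _ + X]mulrC lerD2r hC.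
Qed.

Lemma schur_stable_sum_pow (R : realType) n (A : 'M[R]_n) :
  schur_stable A ->
  exists2 C, 0 < C & forall t, \sum_(k < t) l1norm (A ^+ k) <= C.
Proof.
case: n A => [|n] A stA.
  by exists 1 => // t; rewrite big1// => k _; rewrite /l1norm big_ord0.
pose Ac := map_mx (real_complex R) A.
(* [s] lists the complex eigenvalues with multiplicity, so Cayley-Hamilton makes the product vanish
   and [X = 1] can be taken. *)
have [s Es] := closed_field_poly_normal (char_poly Ac).
rewrite (monicP (char_poly_monic _)) scale1r in Es.
have [z|| C hC] := @sum_l1norm_pow_bounded _ n Ac s 1.
- by rewrite -root_prod_XsubC -Es -eigenvalue_root_char => /stA.
- rewrite mulr1 -(Cayley_Hamilton Ac) Es rmorph_prod.
  by apply: eq_bigr => z _; rewrite rmorphB /= horner_mx_X horner_mx_C.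
have El k : l1norm (Ac ^+ k * 1) = (l1norm (A ^+ k))%:C%C.
  rewrite mulr1 /Ac -rmorphXn /l1norm !rmorph_sum; apply: eq_bigr => i _.
  rewrite rmorph_sum; apply: eq_bigr => j _.
  by rewrite mxE normc_def /= expr0n addr0 sqrtr_sqr.
(* [C] is a complex bound on real sums, hence its real part; the [+ 1] makes the constant positive,
   as [sqr_wsum_le] requires. *)
exists (`|complex.Re C| + 1) => [|t]; first by rewrite ltr_wpDl.
apply: le_trans (_ : complex.Re C <= _); last by rewrite (le_trans (ler_norm _))// lerDl.
have := hC t; under eq_bigr do rewrite El.
by rewrite -rmorph_sum lecE => /andP[].
Qed.

(** * Cauchy-Schwarz and comparison of vector norms *)

(* Cauchy-Schwarz, from \sum_i c i * (C * g i - y) ^+ 2 >= 0 where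
   y = \sum_i c i * g i. *)
Lemma sqr_wsum_le (R : realFieldType) (I : Type) (r : seq I) (c g : I -> R) (C : R) :
  0 < C -> (forall i, 0 <= c i) -> \sum_(i <- r) c i <= C ->
  (\sum_(i <- r) c i * g i) ^+ 2 <= C * \sum_(i <- r) c i * g i ^+ 2.
Proof.
move=> C0 c0 cC; move Ey: (\sum_(i <- r) c i * g i) => y.
set z := \sum_(i <- r) _.
have : 0 <= \sum_(i <- r) c i * (C * g i - y) ^+ 2.
  by apply: sumr_ge0 => i _; rewrite mulr_ge0 ?sqr_ge0.
have -> : \sum_(i <- r) c i * (C * g i - y) ^+ 2 =
   C ^+ 2 * z - 2 * C * y * \sum_(i <- r) c i * g i + y ^+ 2 * \sum_(i <- r) c i.
  rewrite /z !mulr_sumr -sumrN -!big_split /=.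
  by apply: eq_bigr => i _; ring.
(* Replacing the sum of the weights by [C] leaves C^2 z - C y^2 >= 0, which is C times the claim. *)
have := ler_wpM2l (sqr_ge0 y) cC.
rewrite Ey; move: (\sum_(i <- r) c i) => c' h1 h2.
rewrite -(ler_pM2l C0); nra.
Qed.

(** Cauchy-Schwarz with unit weights; [p.+1] keeps the constant positive when [p = 0]. *)
Lemma sqr_l1norm_le (R : realFieldType) p (v : 'cV[R]_p) :
  l1norm v ^+ 2 <= p.+1%:R * \sum_i v i ord0 ^+ 2.
Proof.
have -> : l1norm v = \sum_i 1 * `|v i ord0|.
  by apply: eq_bigr => i _; rewrite big_ord1 mul1r.
apply: le_trans (sqr_wsum_le (C := p.+1%:R) _ _ _ _) _ => //.
  by rewrite sumr_const card_ord ler_nat.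
by rewrite ler_wpM2l// ler_sum// => i _; rewrite mul1r real_normK ?num_real.
Qed.

Lemma sqr_enorm (R : realType) p (v : 'cV[R]_p) :
  enorm v ^+ 2 = \sum_i v i ord0 ^+ 2.
Proof. by rewrite sqr_sqrtr// sumr_ge0// => i _; exact: sqr_ge0. Qed.

Lemma sqr_enorm_le_l1norm (R : realType) p (v : 'cV[R]_p) :
  enorm v ^+ 2 <= l1norm v ^+ 2.
Proof.
rewrite sqr_enorm expr2 [X in _ <= X * _]/l1norm mulr_suml ler_sum// => i _.
rewrite big_ord1 -real_normK ?num_real// expr2 ler_wpM2l//.
rewrite /l1norm (bigD1 i)//= big_ord1 lerDl sumr_ge0// => k _.
by rewrite big_ord1.
Qed.

(** * Pathwise facts: bounded inputs, and the state as a response to forcing *)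

Lemma norm1_mxrow (R : realType) m n N (F : 'I_N -> 'M[R]_(m, n)) j :
  norm1 (row j (\mxrow_(i < N) F i)) = \sum_(i < N) \sum_(k < n) `|F i j k|.
Proof.
rewrite sig_big_dep /= (reindex _ tagnat.sig_bij_on) /=.
by apply: eq_bigr => k _; rewrite !mxE.
Qed.

(** Noise features are at most [phi_max] in modulus, so the triangle inequality on row j gives the
    left side of the constraint. *)
Lemma policy_input_bound (R : realType) n m N (phi : R -> R) (phi_max Umax : R)
    (p : policy R n m) (w : nat -> 'cV[R]_n) t :
  (forall s, `|phi s| <= phi_max) -> feasible N phi_max Umax p -> (t < N)%N ->
  forall j, `|policy_input phi p w t j ord0| <= Umax.
Proof.
move=> phiB feas tN j; apply: le_trans _ (feas t tN).
apply: le_trans _ (le_bigmax _ _ j).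
rewrite /policy_input mxE; apply: le_trans (ler_normD _ _) _; rewrite lerD2l.
rewrite /Theta norm1_mxrow summxE mulr_suml.
(* The sum over i < t is extended to i < N to match the zero blocks of [Theta]. *)
rewrite (big_ord_widen N
  (fun i => (theta p t i *m noise_fun phi (w i)) j ord0)) ?(ltnW tN)//.
rewrite big_mkcond; apply: le_trans (ler_norm_sum _ _ _) _.
apply: ler_sum => i _; case: ifP => _; last first.
  by rewrite normr0 mulr_ge0 ?sumr_ge0 ?(le_trans _ (phiB 0)).
rewrite mxE mulr_suml; apply: le_trans (ler_norm_sum _ _ _) _.
by apply: ler_sum => k _; rewrite mxE normrM ler_wpM2l.
Qed.

(** Variation of constants, the initial state counting as the forcing at time 0. *)
Lemma linear_recurrence_sum (R : nzRingType) n (A : 'M[R]_n)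
    (x z : nat -> 'cV[R]_n) :
  x 0%N = z 0%N -> (forall t, x t.+1 = A *m x t + z t.+1) ->
  forall t, x t = \sum_(s < t.+1) A ^+ s *m z (t - s)%N.
Proof.
move=> x0 xS; elim=> [|t IH].
  by rewrite big_ord1 expr0 subn0 x0 -[1]/(1%:M) mul1mx.
rewrite xS IH mulmx_sumr [RHS]big_ord_recl subn0 expr0 -[1]/(1%:M) mul1mx addrC.
by congr (_ + _); apply: eq_bigr => s _; rewrite exprS -mulmxA.
Qed.

(* Covers non-measurable functions, unlike [expectation_le]: the integral of a
   nonnegative function is a supremum over the simple functions below it. *)
Lemma le_expectation_ge0 d (T : measurableType d) (R : realType)
    (P : probability T R) (X Y : T -> R) :
  (forall o, 0 <= X o) -> (forall o, X o <= Y o) -> ('E_P[X] <= 'E_P[Y])%E.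
Proof.
move=> X0 XY; have Y0 o : 0 <= Y o by exact: le_trans (XY o).
rewrite unlock !ge0_integralE => [|o _|o _]; rewrite ?lee_fin//.
apply: ge_ereal_sup => _ [h hX <-]; apply: ereal_sup_ubound; exists h => // o.
by apply: le_trans (hX o) _; rewrite !patch_setT lee_fin.
Qed.

(** * Linearity of finite means *)

Section has_mean.
Context d (T : measurableType d) (R : realType) (P : probability T R).

Definition has_mean (X : T -> R) (mu : R) : Prop :=
  P.-integrable setT (fun o => (X o)%:E) /\ ('E_P[X] = mu%:E)%E.

Lemma has_mean_cst a : has_mean (fun=> a) a.
Proof.
split; last exact: expectation_cst.
by apply: finite_measure_integrable_cst.
Qed.

Lemma has_meanD X Y mu nu :
  has_mean X mu -> has_mean Y nu -> has_mean (fun o => X o + Y o) (mu + nu).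
Proof.
move=> [iX EX] [iY EY]; split; first exact: (integrableD measurableT iX iY).
by rewrite EFinD -EX -EY unlock -integralD_EFin.
Qed.

Lemma has_meanZ a X mu : has_mean X mu -> has_mean (fun o => a * X o) (a * mu).
Proof.
move=> [iX EX]; split; first exact: (integrableZl measurableT a iX).
by rewrite EFinM -EX unlock -integralZl.
Qed.

Lemma has_mean_sum (I : Type) (r : seq I) (X : I -> T -> R) (mu : I -> R) :
  (forall i, has_mean (X i) (mu i)) ->
  has_mean (fun o => \sum_(i <- r) X i o) (\sum_(i <- r) mu i).
Proof.
move=> XM; elim: r => [|i r IH].
  by rewrite big_nil; under eq_fun do rewrite big_nil; exact: has_mean_cst.
by rewrite big_cons; under eq_fun do rewrite big_cons; exact: has_meanD.
Qed.

Lemma has_mean_ge0 X mu : (forall o, 0 <= X o) -> has_mean X mu -> 0 <= mu.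
Proof. by move=> X0 [_ EX]; rewrite -lee_fin -EX expectation_ge0. Qed.

End has_mean.

(** The squared Euclidean norm of w is the trace of w w^T. *)
Lemma second_moment_has_mean d (T : measurableType d) (R : realType)
    (P : probability T R) n (w : nat -> T -> 'cV[R]_n) (Sigma : 'M[R]_n) t :
  second_moment P w Sigma ->
  has_mean P (fun o => \sum_i w t o i ord0 ^+ 2) (\tr Sigma).
Proof.
move=> wS; apply: has_mean_sum => i.
rewrite (_ : (fun o => _) = (fun o => (w t o *m (w t o)^T) i i)); first exact: wS.
by apply/funext => o; rewrite mxE big_ord1 mxE expr2.
Qed.

(** * Mean-square bound for the closed loop *)

Theorem proposition5p2 (R : realType) (n m : nat)
  (d : measure_display) (T : measurableType d) (P : probability T R)
  (A : 'M[R]_n) (B : 'M[R]_(n, m))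
  (w : nat -> T -> 'cV[R]_n) (Sigma : 'M[R]_n)
  (w_iid : iid P w) (w_Sigma : second_moment P w Sigma)
  (A_stable : schur_stable A)
  (N Nc : nat) (Nc_gt0 : (1 <= Nc)%N) (Nc_le : (Nc <= N)%N)
  (Umax : R) (Umax_gt0 : 0 < Umax)
  (Q : nat -> 'M[R]_n) (Q_posdef : forall k, (k <= N)%N -> sym_posdef (Q k))
  (W : nat -> 'M[R]_m) (W_posdef : forall k, (k < N)%N -> sym_posdef (W k))
  (phi : R -> R) (phi_meas : measurable_fun setT phi)
  (phi_max : R)
  (phi_sup : ereal_sup [set (`|phi s|)%:E | s in [set: R]] = phi_max%:E)
  (phi_mean : forall t i, ('E_P[fun o => noise_fun phi (w t o) i ord0] = 0)%E)
  (pstar : 'cV[R]_n -> policy R n m)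
  (pstar_min : forall xbar,
     is_minimizer A B N Q W phi phi_max Umax P w xbar (pstar xbar))
  (pstar_meas : borel_selection N pstar) :
  forall (x0 : 'cV[R]_n) (x : nat -> T -> 'cV[R]_n) (u : nat -> T -> 'cV[R]_m),
    receding_horizon_loop A B phi w Nc pstar x0 x u ->
    (ereal_sup [set 'E_P[fun o => (enorm (x t o) ^+ 2)%R] | t in [set: nat]]
       < +oo)%E.
Proof.
move=> x0 x u [x0E xS uE].
have phiB s : `|phi s| <= phi_max.
  by rewrite -lee_fin -phi_sup; apply: ereal_sup_ubound; exists s.
have uB t o : l1norm (u t o) <= m%:R * Umax.
  (* Time t is step [t %% Nc] of block [t %/ Nc], and this step is below [Nc <= N], where the
     constraint holds. *)
  rewrite (divn_eq t Nc) uE ?ltn_mod//.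
  have -> : m%:R * Umax = \sum_(j < m) Umax by rewrite sumr_const card_ord mulr_natl.
  apply: ler_sum => j _; rewrite big_ord1.
  apply: policy_input_bound phiB (pstar_min _).1 _ j.
  by rewrite (leq_trans _ Nc_le)// ltn_mod.
have [C C0 AC] := schur_stable_sum_pow A_stable.
pose z o s := if s is s'.+1 then B *m u s' o + w s' o else x0.
(* The first term covers z_0 = x_0, the second is the share of the input in (a + c)^2 <= 2 a^2 + 2
   c^2. *)
pose K := l1norm x0 ^+ 2 + 2 * (l1norm B * (m%:R * Umax)) ^+ 2.
(* [X s] bounds the squared norm of [z ^~ s]; at s = 0, s.-1 = 0 is harmless. *)
pose X s o := K + 2 * n.+1%:R * \sum_i w s.-1 o i ord0 ^+ 2.
pose M := K + 2 * n.+1%:R * \tr Sigma.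
have XM s : has_mean P (X s) M.
  by apply/has_meanD/has_meanZ/second_moment_has_mean => //; exact: has_mean_cst.
have K0 : 0 <= K by rewrite addr_ge0 ?sqr_ge0// mulr_ge0 ?sqr_ge0.
have G0 s o : 0 <= 2 * n.+1%:R * \sum_i w s o i ord0 ^+ 2.
  by rewrite !mulr_ge0// sumr_ge0// => i _; exact: sqr_ge0.
have X0 s o : 0 <= X s o by rewrite addr_ge0.
have zX o s : l1norm (z o s) ^+ 2 <= X s o.
  case: s => [|s] /=.
    by rewrite -[leLHS]addr0 lerD// lerDl mulr_ge0// sqr_ge0.
  have Bu : l1norm (B *m u s o) <= l1norm B * (m%:R * Umax).
    by apply: le_trans (ler_l1normM _ _) _; rewrite ler_wpM2l ?l1norm_ge0.
  have := sqr_l1norm_le (w s o); have := ler_l1normD (B *m u s o) (w s o).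
  have := l1norm_ge0 (B *m u s o); have := l1norm_ge0 (w s o).
  have := l1norm_ge0 (B *m u s o + w s o); have := sqr_ge0 (l1norm x0).
  rewrite /X /K /=; move: Bu.
  move: (l1norm (B *m _)) (l1norm (w _ _)) (l1norm (_ + _)) (l1norm x0 ^+ 2).
  move: (\sum_i _) (l1norm B * _) => g b a c e f ab f0 e0 c0 a0 eac cg.
  (* Here e = |B u + w| <= a + c, where a = |B u| <= b and c = |w|. *)
  suff : e ^+ 2 <= 2 * b ^+ 2 + 2 * c ^+ 2 by lra.
  have : e ^+ 2 <= (a + c) ^+ 2 by rewrite ler_pXn2r ?nnegrE ?addr_ge0.
  have : a ^+ 2 <= b ^+ 2 by rewrite ler_pXn2r ?nnegrE// (le_trans a0).
  have := sqr_ge0 (a - c); lra.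
have M0 : 0 <= M by exact: has_mean_ge0 (XM 0%N).
have xX t o : enorm (x t o) ^+ 2
    <= C * \sum_(s < t.+1) l1norm (A ^+ s) * X (t - s)%N o.
  have -> : x t o = \sum_(s < t.+1) A ^+ s *m z o (t - s)%N.
    apply: (linear_recurrence_sum (x := x ^~ o)) => [|k]; first exact: x0E.
    by rewrite xS addrA.
  apply: le_trans (sqr_enorm_le_l1norm _) _.
  apply: (@le_trans _ _
    ((\sum_(s < t.+1) l1norm (A ^+ s) * l1norm (z o (t - s)%N)) ^+ 2)).
    rewrite ler_pXn2r ?nnegrE ?l1norm_ge0 ?sumr_ge0//; last first.
      by move=> s _; rewrite mulr_ge0 ?l1norm_ge0.
    apply: le_trans (ler_l1norm_sum _ _) _.
    by apply: ler_sum => s _; exact: ler_l1normM.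
  apply: le_trans (sqr_wsum_le _ C0 _ (AC _)) _ => [s|]; first exact: l1norm_ge0.
  rewrite ler_pM2l// ler_sum// => s _.
  by rewrite ler_wpM2l ?l1norm_ge0.
(* One factor [C] comes from Cauchy-Schwarz, the other from the sum of the weights. *)
apply: (@le_lt_trans _ _ (C * (C * M))%:E); last exact: ltry.
apply: ge_ereal_sup => _ [t _ <-].
apply: le_trans (le_expectation_ge0 P (fun o => sqr_ge0 _) (xX t)) _.
have [_ ->] : has_mean P (fun o => C * \sum_(s < t.+1) l1norm (A ^+ s) * X (t - s)%N o)
    (C * \sum_(s < t.+1) l1norm (A ^+ s) * M).
  by apply/has_meanZ/has_mean_sum => s; exact: has_meanZ.
by rewrite lee_fin ler_pM2l// -mulr_suml ler_wpM2r.
Qed.
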